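(* Let $\mathcal{H}$ be a reproducing kernel Hilbert space on a non-empty set $\Omega$, let $T\in B(\mathcal{H})$, let $\mu\in[0,1]$, and let $\sigma_\mu$ be an interpolation path of a symmetric mean $\sigma$. Then, for $p\ge1$, $$\|T\|_{\sigma_\mu\text{-ber}}^p\ge\max\left\{\mathrm{ber}^p(T)\ \sigma_\mu\ \widetilde c^{\,\frac p2}(T^*T),\ \ \widetilde c^{\,p}(T)\ \sigma_\mu\ \|T\|_{ber}^p\right\}.$$
   Context: A reproducing kernel Hilbert space on $\Omega$ is a Hilbert space of complex-valued functions on $\Omega$ whose point evaluations are bounded; $k_\lambda$ is the reproducing kernel at $\lambda\in\Omega$ (assumed nonzero) and $\hat k_\lambda=k_\lambda/\|k_\lambda\|$. $B(\mathcal{H})$ is the algebra of bounded linear operators on $\mathcal{H}$. $\mathrm{ber}(T)=\sup_{\lambda\in\Omega}|\langle T\hat k_\lambda,\hat k_\lambda\rangle|$, $\|T\|_{ber}=\sup_{\lambda\in\Omega}\|T\hat k_\lambda\|$, $\widetilde c(T)=\inf_{\lambda\in\Omega}|\langle T\hat k_\lambda,\hat k_\lambda\rangle|$; superscripts denote powers, e.g. $\widetilde c^{\,q}(T)=(\widetilde c(T))^q$. A mean is a continuous function $\sigma:[0,\infty)^2\to[0,\infty)$, written $a\sigma b$, monotone increasing in each variable, with $a\le a\sigma b\le b$ whenever $a\le b$, and $(\alpha a)\sigma(\alpha b)=\alpha(a\sigma b)$ for $\alpha>0$. It is symmetric if $a\sigma b=b\sigma a$. An interpolation path for a symmetric mean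 $\sigma$ is a family of means $\sigma_\mu$, $\mu\in[0,1]$, each increasing in each component, with $a\sigma_0b=b$, $a\sigma_1b=a$, $a\sigma_{1/2}b=a\sigma b$, and $(a\sigma_\mu b)\sigma(a\sigma_\nu b)=a\sigma_{\frac{\mu+\nu}2}b$ for all $\mu,\nu\in[0,1]$, $a,b\ge0$. For $p\ge1$ and $\mu\in[0,1]$, the $\sigma_\mu$-Berezin norm (depending also on $p$) is $\|T\|_{\sigma_\mu\text{-ber}}=\sup_{\lambda\in\Omega}\left(|\langle T\hat k_\lambda,\hat k_\lambda\rangle|^p\,\sigma_\mu\,\|T\hat k_\lambda\|^p\right)^{1/p}$. *)

(* Defs.v *)
From HB Require Import structures.
From mathcomp Require Import all_boot all_order all_algebra.
From mathcomp Require Import all_classical all_reals all_analysis.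
From mathcomp Require Import complex ring lra.

Set Implicit Arguments.
Unset Strict Implicit.
Unset Printing Implicit Defensive.

Import Order.TTheory GRing.Theory Num.Theory.
Import numFieldNormedType.Exports.

Local Open Scope classical_set_scope.
Local Open Scope ring_scope.
Local Open Scope complex_scope.

(* Over R[i] the library norm takes values in R[i]; the sesquilinear form
   [dotp] is linear in its first argument and conjugate-linear in its
   second. *)
HB.mixin Record CompleteNormedModule_isHilbert (R : realType) H
    of CompleteNormedModule R[i] H := {
  dotp : {dot H for @Num.conj R[i]} ;
  sqr_norm_dotp : forall x : H, `|x| ^+ 2 = dotp x x
}.

#[short(type="hilbertType")]
HB.structure Definition Hilbert (R : realType) :=
  { H of CompleteNormedModule_isHilbert R H & CompleteNormedModule R[i] H }.

(* The elements of H are identified with functions on Omega through the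
   injective pointwise-linear map [feval]. *)
HB.mixin Record Hilbert_isRKHS (R : realType) (Omega : Type) H
    of Hilbert R H := {
  feval : H -> Omega -> R[i] ;
  feval_linear : forall (a : R[i]) (f g : H) (w : Omega),
    feval (a *: f + g) w = a * feval f w + feval g w ;
  feval_inj : injective feval ;
  feval_bounded : forall w : Omega,
    exists M : R, forall f : H, `|feval f w| <= M%:C * `|f|
}.

#[short(type="rkhsType")]
HB.structure Definition RKHS (R : realType) (Omega : Type) :=
  { H of Hilbert_isRKHS R Omega H & Hilbert R H }.

(* real-valued norm, used both for vectors and for the modulus on R[i] *)
Definition rnorm (R : realType) (V : normedZmodType R[i]) (x : V) : R :=
  complex.Re `|x|.

Section Hilbert.
Context {R : realType} {H : hilbertType R}.

Definition bounded_operator (T : H -> H) : Prop :=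
  exists M : R, forall x : H, `|T x| <= M%:C * `|x|.

(* The vector representing a functional; by [rieszP] below, the default
   value 0 is never used for a bounded linear functional. *)
Definition riesz (phi : H -> R[i]) : H :=
  xget 0 [set v : H | forall x : H, phi x = dotp x v].

Definition adjoint (T : H -> H) (y : H) : H := riesz (fun x => dotp (T x) y).

End Hilbert.

Section RieszThm.
Context {R : realType} {H : hilbertType R}.
Implicit Types x y h : H.

Let re (z : R[i]) : R := complex.Re z.
Let reD z w : re (z + w) = re z + re w. Proof. by case: z; case: w. Qed.
Let reN z : re (- z) = - re z. Proof. by case: z. Qed.
Let reZ (t : R) z : re (t%:C * z) = t * re z.
Proof. by case: z => a b; rewrite /re /= mul0r subr0. Qed.
Let reJ z : re (Num.conj z) = re z. Proof. by case: z. Qed.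
Let reI z : re ('i * z) = - complex.Im z.
Proof. by case: z => a b; rewrite /re /=; ring. Qed.

Lemma rnormE (V : normedZmodType R[i]) (x : V) : `|x| = (rnorm x)%:C.
Proof. by rewrite /rnorm RRe_real // ger0_real. Qed.

Let d x y : R := re (dotp x y).
Let dC x y : d x y = d y x.
Proof.
by rewrite /d (hermC dotp) expr0 mul1r; exact: reJ.
Qed.
Let dDl x y h : d (x + y) h = d x h + d y h.
Proof. by rewrite /d linearDl reD. Qed.
Let dZl (t : R) x h : d (t%:C *: x) h = t * d x h.
Proof. by rewrite /d linearZl_LR /= reZ. Qed.
Let dNl x h : d (- x) h = - d x h.
Proof. by rewrite /d linearNl reN. Qed.
Let dDr x y h : d h (x + y) = d h x + d h y.
Proof. by rewrite dC dDl !(dC h). Qed.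
Let dZr (t : R) x h : d h (t%:C *: x) = t * d h x.
Proof. by rewrite dC dZl (dC h). Qed.
Let dNr x h : d h (- x) = - d h x.
Proof. by rewrite dC dNl (dC h). Qed.
Let dd x : d x x = rnorm x ^+ 2.
Proof. by rewrite /d -sqr_norm_dotp rnormE -rmorphXn. Qed.
Let d_ge0 x : 0 <= d x x. Proof. by rewrite dd sqr_ge0. Qed.
Let rnorm_ge0 x : 0 <= rnorm x.
Proof. by have := normr_ge0 x; rewrite rnormE lecR. Qed.

Let quad (a b c : R) : (forall t, - c <= 2 * t * b + t ^+ 2 * a) -> 0 <= a ->
  b ^+ 2 <= c * (a + 1).
Proof.
move=> h a0; have a1 : 0 < a + 1 by lra.
have := h (- b / (a + 1)).
have -> : 2 * (- b / (a + 1)) * b + (- b / (a + 1)) ^+ 2 * a =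
  - (b ^+ 2 / (a + 1)) - (b / (a + 1)) ^+ 2.
  by field; rewrite gt_eqF.
move=> H1; rewrite -ler_pdivrMr //; have := sqr_ge0 (b / (a + 1)); lra.
Qed.

Let cs x y : d x y ^+ 2 <= d x x * (d y y + 1).
Proof.
apply: quad => // t; have := d_ge0 (x + t%:C *: y).
rewrite !dDl !dDr !dZl !dZr (dC y x); lra.
Qed.

Context (phi : H -> R[i]) (M : R).
Context (phi_lin : forall (a : R[i]) x y, phi (a *: x + y) = a * phi x + phi y).
Context (phi_bnd : forall x, `|phi x| <= M%:C * `|x|).

Let f x := re (phi x).
Let phi0 : phi 0 = 0.
Proof. by have := phi_lin (-1) 0 0; rewrite scaler0 addr0 mulN1r addNr. Qed.
Let fD x y : f (x + y) = f x + f y.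
Proof. by rewrite /f -[x]scale1r phi_lin mul1r reD !scale1r. Qed.
Let fZ (t : R) x : f (t%:C *: x) = t * f x.
Proof. by rewrite /f -[_ *: x]addr0 phi_lin phi0 addr0 reZ. Qed.

Let J x := d x x - 2 * f x.

Let J_lb x : - M ^+ 2 <= J x.
Proof.
have h : f x <= M * rnorm x.
  have := phi_bnd x; rewrite (rnormE x) -rmorphM /= => h.
  have := le_trans (normc_ge_Re (phi x)) h; rewrite lecR.
  exact/le_trans/ler_norm.
rewrite /J dd; have := sqr_ge0 (M - rnorm x); nra.
Qed.

Let m := inf (range J).
Let hinf : has_inf (range J).
Proof.
split; first by exists (J 0), 0.
by exists (- M ^+ 2) => _ [x _ <-].
Qed.
Let m_le x : m <= J x.
Proof. by apply: ge_inf; [case: hinf | exists x]. Qed.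

Let near_min (n : nat) : {x | J x < m + n.+1%:R^-1}.
Proof.
apply: cid; have [|_ [x _ <-] h] := @inf_adherent _ (range J) (n.+1%:R^-1) _ hinf.
  by rewrite invr_gt0.
by exists x.
Qed.
Let u n := sval (near_min n).
Let uP n : J (u n) < m + n.+1%:R^-1. Proof. exact: (svalP (near_min n)). Qed.

Let par x y : d (x - y) (x - y) =
  2 * J x + 2 * J y - 4 * J ((2^-1)%:C *: (x + y)).
Proof.
by rewrite /J !(dDl, dDr, dNl, dNr, dZl, dZr, fD, fZ) (dC y x); field.
Qed.

Let u_close N n : (N <= n)%N -> rnorm (u N - u n) ^+ 2 < 4 * N.+1%:R^-1.
Proof.
move=> Nn; rewrite -dd par.
have := uP N; have := uP n; have := m_le ((2^-1)%:C *: (u N + u n)).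
have : (n.+1%:R^-1 : R) <= N.+1%:R^-1.
  by rewrite lef_pV2 ?posrE // ler_nat.
move: (n.+1%:R^-1) (N.+1%:R^-1) (J _) (J _) (J _) => *; lra.
Qed.

Let inv_small (e : R) : 0 < e -> exists N, forall n, (N <= n)%N -> n.+1%:R^-1 < e.
Proof.
move=> e0; exists (Num.truncn e^-1).+1 => n Nn.
rewrite invf_plt ?posrE //; apply: lt_le_trans (truncnS_gt _) _.
by rewrite ler_nat (leq_trans Nn).
Qed.

Let u_cvg : cvg (u @ \oo).
Proof.
apply/cauchy_cvgP/cauchy_exP => e e0.
have [r r0 ->] : exists2 r : R, 0 < r & e = r%:C.
  by exists (re e); [move: e0; rewrite ltcE /= => /andP[] | rewrite /re RRe_real// gtr0_real].
have [N hN] := inv_small (divr_gt0 (exprn_gt0 2 r0) (ltr0Sn R 3)).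
exists (u N); exists N => // n /= Nn.
rewrite -ball_normE /ball_ /= rnormE ltcR -(ltr_pXn2r (ltn0Sn 1)) ?nnegrE ?(ltW r0) //.
apply: lt_trans (u_close Nn) _; have := hN N (leqnn _).
by rewrite ltr_pdivlMr // mulrC.
Qed.

Let v := lim (u @ \oo).

(* first-order condition at the minimizer [v] of [J] *)
Let foc h : f h = d h v.
Proof.
pose a n := d (u n) h - f h.
have an n : a n ^+ 2 <= n.+1%:R^-1 * (d h h + 1).
  apply: quad => // t.
  have := m_le (u n + t%:C *: h); have := uP n.
  rewrite /a /J !(dDl, dDr, dZl, dZr, fD, fZ) (dC h (u n)).
  move: (n.+1%:R^-1) m (d _ _) (d _ _) (d _ _) (f _) (f _) => *; lra.
apply/eqP; rewrite eq_sym -subr_eq0 dC; set b := d v h - f h.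
rewrite -sqrf_eq0 eq_le sqr_ge0 andbT.
set c := d h h + 1; have c0 : 0 < c by rewrite /c; have := d_ge0 h; lra.
apply/ler_addgt0Pl => e e0; rewrite addr0.
have e4 : 0 < e / (4 * c) by rewrite divr_gt0 // mulr_gt0.
have [N hN] := inv_small e4.
pose r := Num.sqrt (e / (4 * c)).
have r0 : 0 < r by rewrite sqrtr_gt0.
have r2 : r ^+ 2 = e / (4 * c) by rewrite sqr_sqrtr // ltW.
have /cvgrPdist_lt/(_ r%:C) : u @ \oo --> v by exact: u_cvg.
rewrite ltcR => /(_ r0) [K _ hK].
pose n := maxn N K.
have h1 : rnorm (v - u n) ^+ 2 < e / (4 * c).
  have := hK n (leq_maxr _ _); rewrite /= rnormE ltcR => h1.
  by rewrite -r2 ltr_pXn2r // ?nnegrE // ltW.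
have h2 := hN n (leq_maxl _ _).
have h3 := an n; have h4 := cs (v - u n) h.
rewrite dd -/c in h4; rewrite -/c in h3.
have h5 : a n ^+ 2 <= e / 4.
  apply: (le_trans h3); rewrite -(ler_pdivlMr _ _ c0); apply: ltW.
  by apply: lt_le_trans h2 _; rewrite invfM mulrA.
have h6 : d (v - u n) h ^+ 2 <= e / 4.
  apply: (le_trans h4); rewrite -(ler_pdivlMr _ _ c0); apply: ltW.
  by apply: lt_le_trans h1 _; rewrite invfM mulrA.
have -> : b = d (v - u n) h + a n by rewrite /b /a dDl dNl; ring.
have := sqr_ge0 (d (v - u n) h - a n); nra.
Qed.

Lemma riesz_exists : exists w : H, forall x, phi x = dotp x w.
Proof.
exists v => h; apply/eqP; rewrite eq_complex; apply/andP; split; apply/eqP.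
  exact: foc.
have := foc ('i *: h).
rewrite /f -['i *: h]addr0 phi_lin phi0 addr0 /d addr0 linearZl_LR /= !reI.
by move/oppr_inj.
Qed.

Lemma rieszP x : phi x = dotp x (riesz phi).
Proof.
have [w hw] := riesz_exists.
exact: (@xgetPex _ 0 [set v : H | forall x : H, phi x = dotp x v]
  (ex_intro _ w hw) x).
Qed.

End RieszThm.

Lemma norm_dotp (R : realType) (H : hilbertType R) (x y : H) :
  `|dotp x y| <= `|x| * `|y|.
Proof.
have [->|y0] := eqVneq y 0; first by rewrite linear0r !normr0 mulr0.
have ny : 0 < `|y| by rewrite normr_gt0.
have := dnorm_ge0 dotp (`|y| ^+ 2 *: x - dotp x y *: y).
have eZ (a b : R[i]) (u v : H) :
    dotp (a *: u) (b *: v) = a * (Num.conj b * dotp u v).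
  by rewrite (linearZl_LR dotp) /= (linearZr_LR dotp).
rewrite dnormB /= !dnormZ -!sqr_norm_dotp eZ.
rewrite [Num.conj _ * _]mulrC -normCK.
rewrite rmorphM /= !rmorphXn /= conj_normC conj_Creal ?normr_real // normrX normr_id.
set a := `|x|; set b := `|y|; set c := `|dotp x y|.
rewrite (_ : _ - _ = b ^+ 2 * ((a * b) ^+ 2 - c ^+ 2)); last by ring.
rewrite pmulr_rge0 ?exprn_gt0 // subr_ge0 ler_pXn2r //.
  by rewrite nnegrE /c normr_ge0.
by rewrite nnegrE mulr_ge0 ?normr_ge0.
Qed.

Lemma adjointP (R : realType) (H : hilbertType R) (T : {linear H -> H}) :
  bounded_operator T -> forall x y : H, dotp (T x) y = dotp x (adjoint T y).
Proof.
move=> [M hM] x y.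
apply: (@rieszP R H (fun x => dotp (T x) y) (M * rnorm y)) => {x} [a x z|x].
  by rewrite linearP linearDl linearZl_LR.
rewrite rmorphM /= -rnormE mulrAC.
exact: le_trans (norm_dotp (T x) y) (ler_wpM2r (normr_ge0 y) (hM x)).
Qed.

Section Berezin.
Context {R : realType} {Omega : Type} {H : rkhsType R Omega}.

Definition rkernel (w : Omega) : H := riesz (fun f : H => feval f w).

Definition nkernel (w : Omega) : H := `|rkernel w|^-1 *: rkernel w.

Definition berezin (T : H -> H) (w : Omega) : R[i] :=
  dotp (T (nkernel w)) (nkernel w).

Definition ber (T : H -> H) : R := sup (range (fun w => rnorm (berezin T w))).

Definition ber_norm (T : H -> H) : R :=
  sup (range (fun w => rnorm (T (nkernel w)))).

(* the quantity c~(T) *)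
Definition ber_inf (T : H -> H) : R :=
  inf (range (fun w => rnorm (berezin T w))).

(* [s] is the mean sigma_mu *)
Definition mean_ber_norm (s : R -> R -> R) (p : R) (T : H -> H) : R :=
  sup (range (fun w =>
    (s (rnorm (berezin T w) `^ p) (rnorm (T (nkernel w)) `^ p)) `^ p^-1)).

End Berezin.

Lemma rkernelP (R : realType) (Omega : Type) (H : rkhsType R Omega)
  (f : H) (w : Omega) : feval f w = dotp f (rkernel w).
Proof.
have [M hM] := feval_bounded (s := H) w.
by apply: (@rieszP R H (feval^~ w) M) => // a x y; exact: feval_linear.
Qed.

Section Means.
Context {R : realType}.

(* A mean is a function on [0, +oo[^2; here [s] is total and only its values
   on nonnegative arguments are constrained. *)
Record is_mean (s : R -> R -> R) : Prop := {
  mean_ge0 : forall a b, 0 <= a -> 0 <= b -> 0 <= s a b ;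
  mean_continuous : {within [set ab : R * R | 0 <= ab.1 /\ 0 <= ab.2],
    continuous (fun ab : R * R => s ab.1 ab.2)} ;
  mean_incrl : forall a a' b, 0 <= a -> a <= a' -> 0 <= b -> s a b <= s a' b ;
  mean_incrr : forall a b b', 0 <= a -> 0 <= b -> b <= b' -> s a b <= s a b' ;
  mean_between : forall a b, 0 <= a -> a <= b -> a <= s a b <= b ;
  mean_homogeneous : forall t a b, 0 < t -> 0 <= a -> 0 <= b ->
    s (t * a) (t * b) = t * s a b
}.

Definition symmetric_mean (s : R -> R -> R) : Prop :=
  is_mean s /\ forall a b, 0 <= a -> 0 <= b -> s a b = s b a.

Record interpolation_path (s : R -> R -> R) (s_ : R -> R -> R -> R) : Prop := {
  path_mean : forall mu, 0 <= mu <= 1 -> is_mean (s_ mu) ;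
  path0 : forall a b, 0 <= a -> 0 <= b -> s_ 0 a b = b ;
  path1 : forall a b, 0 <= a -> 0 <= b -> s_ 1 a b = a ;
  path_half : forall a b, 0 <= a -> 0 <= b -> s_ 2^-1 a b = s a b ;
  path_interp : forall mu nu a b, 0 <= mu <= 1 -> 0 <= nu <= 1 ->
    0 <= a -> 0 <= b ->
    s (s_ mu a b) (s_ nu a b) = s_ ((mu + nu) / 2) a b
}.

End Means.

(* Main.v *)
Require Import Defs.
From HB Require Import structures.
From mathcomp Require Import all_boot all_order all_algebra.
From mathcomp Require Import all_classical all_reals all_analysis.
From mathcomp Require Import complex.
Import Order.TTheory GRing.Theory Num.Theory.
Import numFieldNormedType.Exports.
Local Open Scope classical_set_scope.
Local Open Scope ring_scope.

(** Write [x w] for the modulus of the Berezin symbol of [T] at [w] and [y w]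
    for the norm of [T] at the normalized kernel, so that [x w <= y w] and the
    Berezin symbol of [T^* T] is [y w ^ 2]. For [r < 1], a point [w] that
    almost attains the supremum in one argument, together with the infimum
    bound in the other, gives by monotonicity and homogeneity
    [r * s A B <= s (x w ^ p) (y w ^ p)]; then let [r] tend to [1]. *)

Lemma rnorm_ge0 (R : realType) (V : normedZmodType R[i]) (x : V) :
  0 <= rnorm x.
Proof. by have := normr_ge0 x; rewrite rnormE lecR. Qed.

Lemma rnorm_dotpC (R : realType) (H : hilbertType R) (x y : H) :
  rnorm (dotp x y) = rnorm (dotp y x).
Proof.
by apply: complexI; rewrite -!rnormE (hermC dotp) expr0 mul1r; exact: norm_conjC.
Qed.

(** [adjointP] moves [T] off the first slot only, so conjugate symmetry, harmless for the modulus,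
    first brings [adjoint T] into the second. *)
Lemma rnorm_dotp_adjoint (R : realType) (H : hilbertType R)
    (T : {linear H -> H}) (x : H) : bounded_operator T ->
  rnorm (dotp (adjoint T (T x)) x) = rnorm (T x) ^+ 2.
Proof.
move=> bT; rewrite rnorm_dotpC -adjointP // -sqr_norm_dotp; apply: complexI.
by rewrite -rnormE normrX normr_id rnormE rmorphXn.
Qed.

Section Kernel.
Context {R : realType} {Omega : Type} {H : rkhsType R Omega}.
Implicit Types (T : {linear H -> H}) (w : Omega).

Lemma norm_nkernel w : rkernel w != 0 :> H -> `|nkernel w : H| = 1.
Proof.
by move=> k0; rewrite normrZ normfV normr_id mulVf // normr_eq0.
Qed.

(** Cauchy-Schwarz against the unit vector [nkernel w]. *)
Lemma rnorm_berezin_le (T : H -> H) w : rkernel w != 0 :> H ->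
  rnorm (berezin T w) <= rnorm (T (nkernel w)).
Proof.
move=> k0; rewrite -lecR -!rnormE.
by have := norm_dotp (T (nkernel w)) (nkernel w); rewrite norm_nkernel // mulr1.
Qed.

Lemma berezin_adjoint_comp T w : bounded_operator T ->
  rnorm (berezin (adjoint T \o T) w) = rnorm (T (nkernel w)) ^+ 2.
Proof. by move=> bT; exact: rnorm_dotp_adjoint. Qed.

Lemma rnorm_nkernel_bounded T : (forall w, rkernel w != 0 :> H) ->
  bounded_operator T -> exists M : R, forall w, rnorm (T (nkernel w)) <= M.
Proof.
move=> k0 [M hM]; exists M => w.
by have := hM (nkernel w); rewrite norm_nkernel // mulr1 rnormE lecR.
Qed.

End Kernel.

Section MeanSup.
Context {R : realType}.

(** Homogeneity turns the hypothesis into [r * s a b <= K] for all [r] in ]0, 1[. The passage to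
    [r = 1] is by contradiction. *)
Lemma mean_le_dilate (s : R -> R -> R) (a b K : R) : is_mean s ->
  0 <= a -> 0 <= b ->
  (forall r, 0 < r -> r < 1 -> s (r * a) (r * b) <= K) -> s a b <= K.
Proof.
move=> ms a0 b0 h; rewrite leNgt; apply/negP => Ks.
have h' r : 0 < r -> r < 1 -> r * s a b <= K.
  by move=> r0 r1; rewrite -mean_homogeneous //; exact: h.
have s0 : 0 <= s a b by exact: mean_ge0.
have K0 : 0 <= K.
  (* Any admissible [r] would do here; [0 <= K] later makes the midpoint positive. *)
  apply: le_trans (h' 2^-1 _ _) => //; last by rewrite invf_lt1 // ltr1n.
  by rewrite mulr_ge0.
have sp : 0 < s a b by exact: le_lt_trans Ks.
(* The midpoint [r] of [K / s a b] and 1 is admissible, yet [r * s a b > K]. *)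
have /midf_lt[] : K / s a b < 1 by rewrite ltr_pdivrMr // mul1r.
set r := (_ / 2) => r1 r2.
have /(h' r)/(_ r2) : 0 < r by apply: le_lt_trans r1; rewrite divr_ge0.
by rewrite leNgt -ltr_pdivrMr // r1.
Qed.

Lemma sup_powR_approx (I : Type) (f : I -> R) (p r : R) : [set: I] !=set0 ->
  has_ubound (range f) -> (forall i, 0 <= f i) -> 0 < p -> 0 < r -> r < 1 ->
  exists i, r * sup (range f) `^ p <= f i `^ p.
Proof.
move=> [i0 _] ubf f0 p0 r0 r1; set S := sup _.
have fS i : f i <= S by apply: ub_le_sup => //; exists i.
(* If [S = 0], no value lies strictly above a dilate of [S], but any index works because [p] is
   nonzero and the left side vanishes. *)
have /orP[/eqP S0|S0] : (0 == S) || (0 < S).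
  by rewrite -le_eqVlt; exact: le_trans (fS i0).
  exists i0; rewrite -S0 powR0 ?gt_eqF // mulr0; exact: powR_ge0.
(* The factor is the [p]-th root of [r], so that raising to the power [p] gives back [r]. *)
have tS : r `^ p^-1 * S < S.
  have e1 : 1 = 1 `^ p^-1 :> R by rewrite powR1.
  by rewrite gtr_pMl // [ltRHS]e1 gt0_ltr_powR ?invr_gt0 ?nnegrE ?ltW.
have [|_ [i _ <-] fi] := sup_gt _ tS; first by exists (f i0), i0.
exists i.
have -> : r = (r `^ p^-1) `^ p by rewrite -powRrM mulVf ?gt_eqF // powRr1 // ltW.
rewrite -powRM ?powR_ge0 ?(ltW S0) //.
by apply: ge0_ler_powR; rewrite ?nnegrE ?mulr_ge0 ?powR_ge0 // ltW.
Qed.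

End MeanSup.

(** A real [sup] dominates its set only if the set is bounded above. The bound holds since a mean
    lies below its larger argument, here the [p]-th power of a norm at most [M]. *)
Lemma mean_le_mean_ber_norm (R : realType) (Omega : Type) (H : rkhsType R Omega)
    (T : {linear H -> H}) (s : R -> R -> R) (p : R) (w : Omega) :
  (forall w : Omega, rkernel w != 0 :> H) -> bounded_operator T ->
  is_mean s -> 0 < p ->
  s (rnorm (berezin T w) `^ p) (rnorm (T (nkernel w)) `^ p)
    <= mean_ber_norm s p T `^ p.
Proof.
move=> k0 bT ms p0.
pose g w := s (rnorm (berezin T w) `^ p) (rnorm (T (nkernel w)) `^ p).
have g0 v : 0 <= g v by apply: mean_ge0; rewrite ?powR_ge0.
have [M hM] := rnorm_nkernel_bounded T k0 bT.
have gM v : g v `^ p^-1 <= M `^ p `^ p^-1.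
  have xy : rnorm (berezin T v) `^ p <= rnorm (T (nkernel v)) `^ p.
    by apply: ge0_ler_powR; rewrite ?nnegrE ?rnorm_ge0 ?rnorm_berezin_le // ltW.
  have /andP[_ gy] := mean_between ms (powR_ge0 _ _) xy.
  apply: ge0_ler_powR; rewrite ?nnegrE ?powR_ge0 ?invr_ge0 ?(ltW p0) //.
  apply: le_trans gy _; apply: ge0_ler_powR; rewrite ?nnegrE ?rnorm_ge0 ?(ltW p0) //.
  by apply: le_trans (hM v); exact: rnorm_ge0.
have gN : g w `^ p^-1 <= mean_ber_norm s p T.
  apply: ub_le_sup; last by exists w.
  by exists (M `^ p `^ p^-1) => _ [v _ <-]; exact: gM.
rewrite -/(g w) -[g w](@powRr1 R) // -(mulVf (lt0r_neq0 p0)) powRrM.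
apply: ge0_ler_powR; rewrite ?nnegrE ?powR_ge0 ?(ltW p0) //.
exact: le_trans (powR_ge0 _ _) gN.
Qed.

Theorem theorem2p14 (R : realType) (Omega : Type)
    (Omega_nonempty : [set: Omega] !=set0)
    (H : rkhsType R Omega)
    (rkernel_neq0 : forall w : Omega, rkernel w != 0 :> H)
    (T : {linear H -> H}) (T_bounded : bounded_operator T)
    (sigma : R -> R -> R) (sigma_sym : symmetric_mean sigma)
    (sigma_ : R -> R -> R -> R)
    (sigma_path : interpolation_path sigma sigma_)
    (mu : R) (mu01 : 0 <= mu <= 1) (p : R) (p_ge1 : 1 <= p) :
  Num.max
    (sigma_ mu (ber T `^ p) (ber_inf (adjoint T \o T) `^ (p / 2)))
    (sigma_ mu (ber_inf T `^ p) (ber_norm T `^ p))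
  <= mean_ber_norm (sigma_ mu) p T `^ p.
Proof.
have ms := path_mean sigma_path mu01.
have p0 : 0 < p by exact: lt_le_trans p_ge1.
have [M hM] := rnorm_nkernel_bounded T rkernel_neq0 T_bounded.
have inf_ge0 (S : H -> H) : 0 <= ber_inf S.
  apply: lb_le_inf; last by move=> _ [w _ <-]; exact: rnorm_ge0.
  by have [w _] := Omega_nonempty; exists (rnorm (berezin S w)), w.
have inf_le (S : H -> H) w : ber_inf S <= rnorm (berezin S w).
  apply: ge_inf; last by exists w.
  by exists 0 => _ [v _ <-]; exact: rnorm_ge0.
have shrink (r c : R) : r < 1 -> 0 <= c -> r * c <= c.
  by move=> r1 c0; rewrite ler_piMl // ltW.
(* Both terms of the maximum reduce to finding one point [w] that serves both arguments up to the
   factor [r]. *)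
have step a b : 0 <= a -> 0 <= b ->
    (forall r, 0 < r -> r < 1 -> exists w,
      r * a <= rnorm (berezin T w) `^ p /\ r * b <= rnorm (T (nkernel w)) `^ p) ->
    sigma_ mu a b <= mean_ber_norm (sigma_ mu) p T `^ p.
  move=> a0 b0 h; apply: mean_le_dilate => // r r0 r1.
  have [w [ha hb]] := h r r0 r1.
  apply: le_trans (mean_le_mean_ber_norm _ _ _ _ _ _ w rkernel_neq0 T_bounded ms p0).
  apply: (@le_trans _ _ (sigma_ mu (rnorm (berezin T w) `^ p) (r * b))).
    by apply: mean_incrl; rewrite // mulr_ge0 // ltW.
  by apply: mean_incrr; rewrite // ?powR_ge0 // mulr_ge0 // ltW.
rewrite ge_max; apply/andP; split; apply: step; rewrite ?powR_ge0 // => r r0 r1.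
(* Here [w] almost attains [ber T]; the second argument uses the infimum for [adjoint T \o T]. *)
- have [||w hw] := @sup_powR_approx _ _ (fun w => rnorm (berezin T w)) p r
      Omega_nonempty _ _ p0 r0 r1.
  + exists M => _ [w _ <-].
    exact: le_trans (rnorm_berezin_le _ _ (rkernel_neq0 w)) (hM w).
  + by move=> w; exact: rnorm_ge0.
  exists w; split=> //; apply: le_trans (shrink _ _ r1 (powR_ge0 _ _)) _.
  have := inf_le (adjoint T \o T) w; rewrite berezin_adjoint_comp // => hi.
  (* The exponent [p / 2] compensates the square in the Berezin symbol of [adjoint T \o T]. *)
  have -> : rnorm (T (nkernel w)) `^ p = (rnorm (T (nkernel w)) ^+ 2) `^ (p / 2).
    by rewrite -powR_mulrn ?rnorm_ge0 // -powRrM mulrC divfK // pnatr_eq0.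
  apply: ge0_ler_powR; rewrite ?nnegrE ?sqr_ge0 // ?divr_ge0 ?(ltW p0) //.
(* The roles are exchanged: [w] almost attains [ber_norm T], and [ber_inf T] bounds the first
   argument. *)
- have [||w hw] := @sup_powR_approx _ _ (fun w => rnorm (T (nkernel w))) p r
      Omega_nonempty _ _ p0 r0 r1.
  + by exists M => _ [w _ <-].
  + by move=> w; exact: rnorm_ge0.
  exists w; split=> //; apply: le_trans (shrink _ _ r1 (powR_ge0 _ _)) _.
  by apply: ge0_ler_powR; rewrite ?nnegrE ?rnorm_ge0 ?(ltW p0).
Qed.
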